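(* Let $S=(s_1,s_2,s_3,\ldots)$ be a packing sequence with $s_1=1$ and $s_2\ge 4$. Then a graph $G$ is $4$-$\chi_S$-vertex-critical if and only if $$G\in\{K_4,C_5,C_6,P_6\}\cup\mathcal{C}_5\cup\mathcal{C}_6\cup\{H_1,H_2,H_3,H_4,H_5,H_6,H_7,H_8\}.$$
   Context: All graphs are finite, simple and undirected; graphs are considered up to isomorphism ($G=H$ and $G\in\mathcal{F}$ are meant up to isomorphism). $d_G(u,v)$ is the length of a shortest $u,v$-path in $G$ (infinite if there is none). $C_n,P_n,K_n$ are the cycle, path and complete graph on $n$ vertices. A packing sequence is a non-decreasing sequence $S=(s_1,s_2,\ldots)$ of positive integers. An $S$-packing $k$-coloring of $G$ is a map $c:V(G)\to\{1,\ldots,k\}$ such that if $u\ne v$ and $c(u)=c(v)=i$, then $d_G(u,v)>s_i$. The $S$-packing chromatic number $\chi_S(G)$ is the smallest $k$ such that $G$ has an $S$-packing $k$-coloring. $G$ is $\chi_S$-vertex-critical if $\chi_S(G-u)<\chi_S(G)$ for every $u\in V(G)$; it is $4$-$\chi_S$-vertex-critical if moreover $\chi_S(G)=4$. $\mathcal{C}_5$ (not to be confused with the cycle $C_5$) is the family of the four graphs obtained from the 5-cycle $v_1v_2v_3v_4v_5v_1$ by adding one of the following sets of chords: $\{v_1v_3\}$; $\{v_1v_3,v_1v_4\}$; $\{v_1v_3,v_2v_4\}$; $\{v_1v_4,v_2v_5,v_3v_5\}$ (the last graph is the wheel consisting of a 4-cycle and a vertex adjacent to all its vertices). $\mathcal{C}_6$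 is the family of the three graphs obtained from the 6-cycle $v_1v_2v_3v_4v_5v_6v_1$ by adding one, two, or all three of the chords $v_1v_4,v_2v_5,v_3v_6$. The graphs $H_i$ are given by edge sets (vertices are the letters occurring): $H_1$: $ab,bc,cd,da,bd,ae$. $H_2$: $ab,bc,ca,cd,de,ec$. $H_3$: $ab,bc,ca,ad,be,cf$. $H_4$: $ab,bc,ca,bd,de$. $H_5$: $ab,bc,cd,da,bf,ce$. $H_6$: $ab,bc,cd,da,ce,ef$. $H_7$: $ab,bc,cd,da,ce,bf,df$. $H_8$: $ab,bc,cd,de,cf$. *)

(* Defs.v *)
From mathcomp Require Import all_boot.
From Stdlib Require List.
Set Implicit Arguments.
Unset Strict Implicit.
Unset Printing Implicit Defensive.

Record sgraph := SGraph {
  vertex :> finType;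
  adj : rel vertex;
  adj_sym : symmetric adj;
  adj_irrefl : irreflexive adj
}.

Definition isomorphic (G H : sgraph) : Prop :=
  exists2 f : G -> H, bijective f & forall x y, adj (f x) (f y) = adj x y.

Section Deletion.
Variables (G : sgraph) (u : G).

Definition del_adj : rel {x : G | x != u} := fun x y => adj (val x) (val y).

Fact del_adj_sym : symmetric del_adj.
Proof. by move=> x y; apply: adj_sym. Qed.

Fact del_adj_irrefl : irreflexive del_adj.
Proof. by move=> x; apply: adj_irrefl. Qed.

Definition del_vertex : sgraph := SGraph del_adj_sym del_adj_irrefl.

End Deletion.

Section Distance.
Variable G : sgraph.

Definition has_path (u v : G) (n : nat) : bool :=
  [exists p : n.-tuple G,
    [&& path (@adj G) u p, last u p == v & uniq (u :: p)]].

(* None stands for an infinite distance.  A path repeats no vertex, so its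
   length is smaller than #|G|. *)
Definition dist (u v : G) : option nat :=
  let n := find (has_path u v) (iota 0 #|G|) in
  if n < #|G| then Some n else None.

Definition dist_gt (u v : G) (m : nat) : bool :=
  if dist u v is Some d then m < d else true.

End Distance.

(* Sequences and colours are indexed from 0: s i is s_(i+1), and the colour
   i : 'I_k is the colour i+1. *)
Definition packing_sequence (s : nat -> nat) : Prop :=
  (forall i, 0 < s i) /\ {homo s : i j / i <= j}.

Section PackingColoring.
Variable s : nat -> nat.

Definition packing_coloring (G : sgraph) (k : nat) (c : {ffun G -> 'I_k}) :
    bool :=
  [forall u, forall v, (u != v) && (c u == c v) ==> dist_gt u v (s (c u))].

Definition packing_colorable (G : sgraph) (k : nat) : bool :=
  [exists c : {ffun G -> 'I_k}, packing_coloring c].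

Lemma packing_colorable_ex (G : sgraph) : exists k, packing_colorable G k.
Proof.
exists #|G|; apply/existsP; exists [ffun x => enum_rank x].
apply/'forall_forallP => u v; apply/implyP; rewrite !ffunE => /andP[neq_uv].
by rewrite (inj_eq enum_rank_inj) (negPf neq_uv).
Qed.

Definition packing_chi (G : sgraph) : nat := ex_minn (packing_colorable_ex G).

Definition chi_vertex_critical (G : sgraph) : Prop :=
  forall u : G, packing_chi (del_vertex u) < packing_chi G.

Definition k_chi_vertex_critical (k : nat) (G : sgraph) : Prop :=
  chi_vertex_critical G /\ packing_chi G = k.

End PackingColoring.

Section GraphOfRel.
Variables (V : finType) (r : rel V).

Definition sym_rel : rel V := fun x y => (x != y) && (r x y || r y x).

Fact sym_rel_sym : symmetric sym_rel.
Proof. by move=> x y; rewrite /sym_rel eq_sym orbC. Qed.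

Fact sym_rel_irrefl : irreflexive sym_rel.
Proof. by move=> x; rewrite /sym_rel eqxx. Qed.

Definition graph_of_rel : sgraph := SGraph sym_rel_sym sym_rel_irrefl.

End GraphOfRel.

Definition complete_graph (n : nat) : sgraph :=
  graph_of_rel (fun _ _ : 'I_n => true).

Definition path_graph (n : nat) : sgraph :=
  graph_of_rel (fun i j : 'I_n => j == i.+1 :> nat).

Definition cycle_graph (n : nat) : sgraph :=
  graph_of_rel (fun i j : 'I_n => j == i.+1 %% n :> nat).

(* The vertex i : 'I_n of the cycle is v_(i+1); chords are given by the
   1-based labels of their endpoints. *)
Definition cycle_with_chords (n : nat) (es : seq (nat * nat)) : sgraph :=
  graph_of_rel (fun i j : 'I_n =>
    (@adj (cycle_graph n) i j) || ((i.+1, j.+1) \in es)).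

Definition family_C5 : seq sgraph :=
  [seq cycle_with_chords 5 es | es <-
    [:: [:: (1, 3)];
        [:: (1, 3); (1, 4)];
        [:: (1, 3); (2, 4)];
        [:: (1, 4); (2, 5); (3, 5)]]].

(* The rotations of the 6-cycle permute its three long chords cyclically, so up
   to isomorphism only the number of added chords matters. *)
Definition family_C6 : seq sgraph :=
  [seq cycle_with_chords 6 es | es <-
    [:: [:: (1, 4)];
        [:: (1, 4); (2, 5)];
        [:: (1, 4); (2, 5); (3, 6)]]].

Definition graph_of_edges (n : nat) (es : seq (nat * nat)) : sgraph :=
  graph_of_rel (fun i j : 'I_n => (val i, val j) \in es).

Section SporadicGraphs.
Let a := 0.
Let b := 1.
Let c := 2.
Let d := 3.
Let e := 4.
Let f := 5.

Definition H1 := graph_of_edges 5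
  [:: (a, b); (b, c); (c, d); (d, a); (b, d); (a, e)].
Definition H2 := graph_of_edges 5
  [:: (a, b); (b, c); (c, a); (c, d); (d, e); (e, c)].
Definition H3 := graph_of_edges 6
  [:: (a, b); (b, c); (c, a); (a, d); (b, e); (c, f)].
Definition H4 := graph_of_edges 5
  [:: (a, b); (b, c); (c, a); (b, d); (d, e)].
Definition H5 := graph_of_edges 6
  [:: (a, b); (b, c); (c, d); (d, a); (b, f); (c, e)].
Definition H6 := graph_of_edges 6
  [:: (a, b); (b, c); (c, d); (d, a); (c, e); (e, f)].
Definition H7 := graph_of_edges 6
  [:: (a, b); (b, c); (c, d); (d, a); (c, e); (b, f); (d, f)].
Definition H8 := graph_of_edges 6
  [:: (a, b); (b, c); (c, d); (d, e); (c, f)].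

End SporadicGraphs.

Definition mem_up_to_iso (G : sgraph) (Hs : seq sgraph) : Prop :=
  exists2 H, List.In H Hs & isomorphic G H.

(* Main.v *)
Require Import Defs.
From mathcomp Require Import all_boot.
Set Implicit Arguments.
Unset Strict Implicit.
Unset Printing Implicit Defensive.

(** The theorem rests on a description of 3-colorability by forbidden
    subgraphs ([colorable3_free]): when s_1 = 1 and s_2, s_3 >= 4, a graph is
    S-packing 3-colorable if and only if it contains, as a not necessarily
    induced subgraph, none of the five patterns K_4, C_5, the flag (a triangle
    with a tail of two edges), P_6, and the spider (a P_5 with a pendant edge at
    its middle vertex).

    Distances only shrink in a supergraph, so a pattern excludes a 3-coloring
    as soon as the pattern itself, with color 1 forbidden at distance 1 and
    colors 2 and 3 forbidden up to distance 4, has none; this is a finite check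
    ([patterns_uncolorable]).  Conversely, if in every component two vertices
    cover all edges, then giving them colors 2 and 3, and color 1 to everything
    else, is a valid coloring ([cover_colorable]): two vertices of color 2, or of
    color 3, lie in different components.  Such a cover
    exists in a pattern-free component ([component_cover]): consider a longest
    path of the component, which has at most five vertices.  Its second and
    fourth vertices (or, on a shorter path, two suitable vertices) meet every
    edge, because an edge avoiding them would complete one of the patterns or
    give a longer path.

    If G is critical with chromatic number 4, then some pattern F is contained
    in G, whereas no G - u contains a pattern.  So F covers all vertices of G
    ([spanning]), and G has no pattern on fewer vertices.  It remains to add
    chords to each pattern and to sort the resulting graphs on at most six
    vertices: either a smaller pattern appears or the graph is in the list
    ([patterns_classified]).  In the other direction each listed graph contains
    a pattern, and after deleting any vertex two vertices cover its edges
    ([codes_minimal]).  That gives chromatic number exactly 4, the deleted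
    vertex taking color 4, and criticality. *)

(** * Distances and colorings *)

(** Walks may replace paths in the definition of the distance, since a walk
    can be shortened to a path with the same ends. *)
Lemma dist_gtP (G : sgraph) (u v : G) m :
  reflect (forall p, path (@adj G) u p -> last u p = v -> m < size p)
          (dist_gt u v m).
Proof.
pose n := find (has_path u v) (iota 0 #|G|).
have short p : path (@adj G) u p -> last u p = v -> n < #|G| /\ n <= size p.
  move=> up_p; case/shortenP: up_p => p' up_p' Up' sub_p'p lastp'.
  have lt_p'G : size p' < #|G|.
    by rewrite -[X in X <= _]/(size (u :: p')) -(card_uniqP Up') max_card.
  have hp' : has_path u v (size p').
    by apply/existsP; exists (in_tuple p'); rewrite up_p' Up' lastp' eqxx.
  have le_np' : n <= size p'.
    rewrite leqNgt; apply/negP => /(before_find 0).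
    by rewrite nth_iota // hp'.
  split; first exact: leq_ltn_trans lt_p'G.
  by apply: leq_trans le_np' (uniq_leq_size _ sub_p'p); case/andP: Up'.
rewrite /dist_gt /dist -/n; case: ifP => [ltnG | geGn].
  apply: (iffP idP) => [lt_mn p up_p lastp | far].
    by apply: leq_trans lt_mn (proj2 (short p up_p lastp)).
  have: has (has_path u v) (iota 0 #|G|) by rewrite has_find size_iota.
  move/(nth_find 0); rewrite -/n nth_iota // => /existsP[p].
  case/and3P=> up_p /eqP lastp _.
  by have := far p up_p lastp; rewrite size_tuple.
by apply: ReflectT => p up_p lastp; have [] := short p up_p lastp; rewrite geGn.
Qed.

Lemma packing_chi_le s (G : sgraph) k :
  (packing_chi s G <= k) = packing_colorable s G k.
Proof.
rewrite /packing_chi; case: ex_minnP => n /existsP[c ccol] n_min.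
apply/idP/idP => [le_nk | /n_min //].
apply/existsP; exists [ffun x => widen_ord le_nk (c x)].
apply/'forall_forallP => u v; rewrite !ffunE.
by have /'forall_forallP/(_ u v) := ccol.
Qed.

(** Color 1 goes to the complement of the covers, which is independent, and
    every other color occurs at most once in each component, so that two
    vertices that share it are at infinite distance.  The list [W r] covers the edges of the
    component with representative [r]. *)
Lemma cover_colorable s (G : sgraph) k (W : G -> seq G) : s 0 = 1 ->
  (forall r, size (W r) <= k) ->
  (forall x y, adj x y ->
     let r := root (@adj G) x in (x \in W r) || (y \in W r)) ->
  packing_colorable s G k.+1.
Proof.
move=> s0 sizeW coverW; pose R (x : G) := W (root (@adj G) x).
pose f x := if x \in R x then (index x (R x)).+1 else 0.
have f_lt x : f x < k.+1.
  rewrite /f; case: ifP => // Rx.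
  by rewrite ltnS; apply: leq_trans (sizeW (root (@adj G) x)); rewrite index_mem.
have Gsym : connect_sym (@adj G) by apply: sym_connect_sym; apply: adj_sym.
apply/existsP; exists [ffun x => Ordinal (f_lt x)].
apply/'forall_forallP => u v; rewrite !ffunE.
apply/implyP => /andP[neq_uv /eqP[eqf]].
apply/dist_gtP => p up_p lastp.
have eqR : R u = R v.
  rewrite /R; congr W; apply/eqP; rewrite root_connect //.
  by apply/connectP; exists p.
move: eqf; rewrite /= {1 2}/f -eqR; case: ifP => Ru; case: ifP => Rv //.
  by case=> eq_uv; rewrite -(nth_index u Ru) eq_uv nth_index ?eqxx in neq_uv.
move=> _; rewrite /f Ru s0.
case: p up_p lastp => [_ /= /eqP | y [/= | //]]; first by rewrite (negPf neq_uv).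
rewrite andbT => uy eq_yv; move: uy; rewrite eq_yv => uv.
by have:= coverW _ _ uv; rewrite /= -/(R u) Ru Rv.
Qed.

(** * Forbidden subgraphs *)

(** The number of vertices, named 0, 1, ..., and the edges. *)
Definition pattern := (nat * seq (nat * nat))%type.

Definition edge (es : seq (nat * nat)) : rel nat :=
  fun i j => ((i, j) \in es) || ((j, i) \in es).

Definition realizes (G : sgraph) (F : pattern) (x0 : G) (vs : seq G) :=
  [&& size vs == F.1, uniq vs
    & all (fun e => adj (nth x0 vs e.1) (nth x0 vs e.2)) F.2].

Definition contains (G : sgraph) (F : pattern) : bool :=
  [exists x0 : G, exists vs : F.1.-tuple G, realizes F x0 vs].

Lemma containsP (G : sgraph) F :
  reflect (exists x0 vs, @realizes G F x0 vs) (contains G F).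
Proof.
apply: (iffP existsP) => [[x0 /existsP[vs Fvs]] | [x0 [vs Fvs]]]; exists x0.
  by exists vs.
have /and3P[/eqP sizevs _ _] := Fvs.
by apply/existsP; exists (tcast sizevs (in_tuple vs)); rewrite val_tcast.
Qed.

Lemma realizes_adj (G : sgraph) F (x0 : G) vs i j :
  realizes F x0 vs -> edge F.2 i j -> adj (nth x0 vs i) (nth x0 vs j).
Proof.
by case/and3P=> _ _ /allP Fvs /orP[] /Fvs //=; rewrite adj_sym.
Qed.

Definition pairs n := [seq (i, j) | i <- iota 0 n, j <- iota 0 i].

Lemma pairs_lt n p : p \in pairs n -> p.2 < p.1 < n.
Proof.
by case/allpairsPdep => i [j [+ + ->]]; rewrite !mem_iota /= => -> ->.
Qed.

(** Distance at most [k] in the pattern. *)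
Fixpoint near (F : pattern) k i j : bool :=
  if k is k'.+1 then
    near F k' i j || has (fun l => edge F.2 i l && near F k' l j) (iota 0 F.1)
  else i == j.

Lemma near_path (G : sgraph) F (x0 : G) vs k i j :
  realizes F x0 vs -> near F k i j ->
  exists2 p, path (@adj G) (nth x0 vs i) p
           & last (nth x0 vs i) p = nth x0 vs j /\ size p <= k.
Proof.
move=> Fvs; elim: k i => [|k IHk] i /=; first by move/eqP->; exists [::].
case/orP => [/IHk[p pP [lastp sizep]] | /hasP[l _ /andP[il]]].
  by exists p; rewrite // lastp leqW.
case/IHk=> p pP [lastp sizep].
by exists (nth x0 vs l :: p); rewrite //= (realizes_adj Fvs il).
Qed.

Fixpoint all_words (m n : nat) (P : pred (seq nat)) : bool :=
  if n is n'.+1 then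
    all (fun x => all_words m n' (fun w => P (x :: w))) (iota 0 m)
  else P [::].

Lemma all_wordsP m n P w :
  all_words m n P -> size w = n -> all (fun x => x < m) w -> P w.
Proof.
elim: n P w => [|n IHn] P [|x w] //= /allP Pw [sizew] /andP[ltxm ltw].
by apply: (IHn (fun w => P (x :: w))) => //; apply: Pw; rewrite mem_iota.
Qed.

(** Every coloring [w] of the pattern has two equally colored vertices at
    distance 1 for the first color, at distance at most 4 for the others: such
    a pair is a conflict for every admissible s, inside every supergraph. *)
Definition uncolorable (F : pattern) : bool :=
  let close k := [seq p <- pairs F.1 | near F k p.1 p.2] in
  let forbidden := [:: close 1; close 4; close 4] in
  all_words 3 F.1 (fun w =>
    has (fun x => has (fun p => (nth 0 w p.1 == x) && (nth 0 w p.2 == x))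
                      (nth [::] forbidden x)) (iota 0 3)).

Lemma uncolorable_contains s (G : sgraph) F :
  packing_sequence s -> s 0 = 1 -> 4 <= s 1 ->
  uncolorable F -> contains G F -> ~~ packing_colorable s G 3.
Proof.
move=> [_ s_mono] s0 s1 unF /containsP[x0 [vs Fvs]].
have /and3P[/eqP sizevs Uvs _] := Fvs.
apply/negP => /existsP[c /'forall_forallP cP].
pose w := [seq val (c v) | v <- vs].
have w_lt : all (fun x => x < 3) w.
  by apply/allP => _ /mapP[v _ ->]; apply: ltn_ord.
have sizew : size w = F.1 by rewrite size_map.
have /hasP[x + /hasP[[i j] + /andP[/eqP /= wi /eqP /= wj]]] :=
  all_wordsP unF sizew w_lt.
rewrite mem_iota /= => ltx3 close_ij.
pose k := if x == 0 then 1 else 4.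
have {close_ij} : (i, j) \in [seq p <- pairs F.1 | near F k p.1 p.2].
  by case: x ltx3 close_ij {wi wj} @k => [|[|[|]]].
rewrite mem_filter /= => /andP[/(near_path Fvs)[p pP [lastp sizep]]].
case/pairs_lt/andP => /= lt_ji lt_iF.
have lt_jF := ltn_trans lt_ji lt_iF.
move: wi wj; rewrite !(nth_map x0) ?sizevs // => ci cj.
have := cP (nth x0 vs i) (nth x0 vs j).
rewrite nth_uniq ?sizevs // gtn_eqF //= -val_eqE /= ci cj eqxx /=.
move/dist_gtP/(_ p pP lastp); apply/negP; rewrite -leqNgt.
apply: leq_trans sizep _; rewrite /k; case: eqP => [-> | /eqP].
  by rewrite s0.
by rewrite -lt0n => /s_mono; apply: leq_trans.
Qed.

Definition K4 : pattern :=
  (4, [:: (0, 1); (0, 2); (0, 3); (1, 2); (1, 3); (2, 3)]).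
Definition C5 : pattern := (5, [:: (0, 1); (1, 2); (2, 3); (3, 4); (4, 0)]).
Definition flag : pattern := (5, [:: (0, 1); (1, 2); (2, 0); (2, 3); (3, 4)]).
Definition P6 : pattern := (6, [:: (0, 1); (1, 2); (2, 3); (3, 4); (4, 5)]).
Definition spider : pattern := (6, [:: (0, 1); (1, 2); (2, 3); (3, 4); (2, 5)]).

Definition patterns := [:: K4; C5; flag; P6; spider].

(** All patterns are connected, and no two vertices cover their edges, so color
    2 or 3 is needed three times.  All distances are at most 4 except between
    the ends of P_6; but giving both ends color 2, say, leaves only color 3 for
    the two disjoint outer edges of the path between them, and needs it twice. *)
Lemma patterns_uncolorable : all uncolorable patterns.
Proof. by lazy. Qed.

(** * Two vertices cover a pattern-free component *)

Section PatternFree.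
Variable G : sgraph.
Hypothesis free : forall F, F \in patterns -> ~~ contains G F.
Notation "x -- y" := (@adj G x y) (at level 70, no associativity).

Let adjC x y : (x -- y) = (y -- x). Proof. exact: adj_sym. Qed.

Lemma free_realizes F (x0 : G) vs : F \in patterns -> ~~ realizes F x0 vs.
Proof.
move=> /free; apply: contra => Fvs.
by apply/containsP; exists x0, vs.
Qed.

(* Decides conjunctions of adjacencies and disequalities that are known up to
   symmetry. *)
Ltac by_known :=
  rewrite /= ?inE ?negb_or ?andbT; repeat (apply/andP; split);
  by [| rewrite eq_sym | rewrite adjC].

(* Splits [uniq [:: ...]] into pairwise disequalities in the context. *)
Ltac distinct U :=
  let H := fresh in
  have H := U; rewrite /= !inE ?negb_or ?andbT in H; move: H;
  repeat (match goal with
          | |- is_true (_ && _) -> _ => case/andP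
          | |- is_true _ -> _ => move=> ? end).

(* Closes a goal whose context makes the vertices [vs] a copy of [F]. *)
Ltac absurd_pattern F vs := exfalso;
  match vs with ?x :: _ =>
    apply: (negP (@free_realizes F x vs isT)); rewrite /realizes; by_known end.

Lemma neq_adj x y : x -- y -> y != x.
Proof. by apply: contraTneq => ->; rewrite adj_irrefl. Qed.

(** Any other neighbor of the end of a P_5 gives a flag (the middle vertex), a
    C_5 (the other end) or a P_6 (a vertex outside of the path). *)
Lemma end_P5 p1 p2 p3 p4 p5 y : uniq [:: p1; p2; p3; p4; p5] ->
  p1 -- p2 -> p2 -- p3 -> p3 -- p4 -> p4 -- p5 -> p1 -- y ->
  y \in [:: p2; p4].
Proof.
move=> U e12 e23 e34 e45 e1y; apply: contraT.
rewrite !inE negb_or => /andP[y2 y4].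
distinct U; have y1 := neq_adj e1y.
have [y3 | y3] := eqVneq y p3.
  by subst y; absurd_pattern flag [:: p1; p2; p3; p4; p5].
have [y5 | y5] := eqVneq y p5.
  by subst y; absurd_pattern C5 [:: p1; p2; p3; p4; p5].
by absurd_pattern P6 [:: y; p1; p2; p3; p4; p5].
Qed.

(** Any other neighbor of the middle of a P_5 gives a flag (an end) or a spider
    (a vertex outside of the path). *)
Lemma mid_P5 p1 p2 p3 p4 p5 y : uniq [:: p1; p2; p3; p4; p5] ->
  p1 -- p2 -> p2 -- p3 -> p3 -- p4 -> p4 -- p5 -> p3 -- y ->
  y \in [:: p2; p4].
Proof.
move=> U e12 e23 e34 e45 e3y; apply: contraT.
rewrite !inE negb_or => /andP[y2 y4].
distinct U; have y3 := neq_adj e3y.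
have [y1 | y1] := eqVneq y p1.
  by subst y; absurd_pattern flag [:: p1; p2; p3; p4; p5].
have [y5 | y5] := eqVneq y p5.
  by subst y; absurd_pattern flag [:: p5; p4; p3; p2; p1].
by absurd_pattern spider [:: p1; p2; p3; p4; p5; y].
Qed.

Definition covers (a b : G) (r : G) :=
  forall x y, connect (@adj G) r x -> x -- y ->
    (x \in [:: a; b]) || (y \in [:: a; b]).

(** A set that meets the component and is closed under adjacency contains it,
    so that only edges at the set have to be examined. *)
Lemma covers_closed (A : pred G) r p a b :
  connect (@adj G) r p -> A p ->
  (forall x y, A x -> x -- y ->
    A y /\ (x \in [:: a; b]) || (y \in [:: a; b])) ->
  covers a b r.
Proof.
move=> rp Ap clA x y rx xy; apply: (proj2 (clA x y _ xy)).
have /connectP[q pq ->] : connect (@adj G) p x.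
  by apply: connect_trans rx; rewrite (sym_connect_sym (@adj_sym G)).
elim: q p Ap pq {rp} => //= z q IHq p Ap /andP[pz zq].
by apply: IHq zq; have [] := clA _ _ Ap pz.
Qed.

Definition has_upath (r : G) k := [exists t : k.-tuple G,
  [&& connect (@adj G) r (head r t), sorted (@adj G) t & uniq t]].

(** The second and fourth vertices cover.  The component consists of the path
    and of their neighbors: a neighbor [x] of [p2] outside of the path starts
    the path [x p2 p3 p4 p5], to which [end_P5] applies as well. *)
Lemma cover_P5 r : has_upath r 5 -> exists a b, covers a b r.
Proof.
case/existsP; case=> [[|p1 [|p2 [|p3 [|p4 [|p5 []]]]]]] //= _.
rewrite andbT => /and3P[rp1 /and4P[e12 e23 e34 e45] U].
have U' : uniq [:: p5; p4; p3; p2; p1].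
  exact: etrans (rev_uniq [:: p1; p2; p3; p4; p5]) U.
exists p2, p4.
pose A x := [|| x \in [:: p1; p2; p3; p4; p5], p2 -- x | p4 -- x].
apply: (@covers_closed A _ p1) => //; rewrite {}/A.
  by rewrite inE eqxx.
move=> x y Ax xy.
have [x24 | x24] := boolP (x \in [:: p2; p4]).
  by split=> //; move: x24 xy; rewrite !inE => /orP[] /eqP-> ->; rewrite !orbT.
suff y24 : y \in [:: p2; p4].
  by rewrite y24; split=> //; move: y24; rewrite !inE => /orP[] ->; rewrite !orbT.
rewrite !inE negb_or in x24; case/andP: x24 => x2 x4.
distinct U.
have [xP | xP] := boolP (x \in [:: p1; p2; p3; p4; p5]).
  rewrite !inE in xP; move: x2 x4 xy.
  case/or4P: xP => [||| /orP[]] /eqP->; rewrite ?eqxx //= => _ _ xy.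
  - exact: (@end_P5 p1 p2 p3 p4 p5).
  - exact: (@mid_P5 p1 p2 p3 p4 p5).
  have := @end_P5 p5 p4 p3 p2 p1 y U'; rewrite !inE orbC.
  by apply; rewrite // adjC.
rewrite (negPf xP) /= in Ax; rewrite !inE !negb_or in xP.
case/and5P: xP => x1 _ x3 _ x5; case/orP: Ax => e.
  by apply: (@end_P5 x p2 p3 p4 p5); by_known.
have := @end_P5 x p4 p3 p2 p1 y; rewrite !inE orbC.
by apply; by_known.
Qed.

(** If the ends of the path are adjacent, the resulting 4-cycle is the whole
    component, and since it does not induce K_4, two opposite vertices are not
    adjacent; the other two cover.  Otherwise the two inner vertices cover. *)
Lemma cover_P4 r :
  ~~ has_upath r 5 -> has_upath r 4 -> exists a b, covers a b r.
Proof.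
move=> no5; case/existsP; case=> [[|p1 [|p2 [|p3 [|p4 []]]]]] //= _.
rewrite andbT => /and3P[rp1 /and3P[e12 e23 e34] U].
have no5r q1 q2 q3 q4 q5 : connect (@adj G) r q1 ->
  q1 -- q2 -> q2 -- q3 -> q3 -- q4 -> q4 -- q5 ->
  uniq [:: q1; q2; q3; q4; q5] -> False.
  move=> rq1 f12 f23 f34 f45 Uq; case/negP: no5; apply/existsP.
  by exists [tuple q1; q2; q3; q4; q5]; rewrite /= rq1 f12 f23 f34 f45.
have step q q' : connect (@adj G) r q -> q -- q' -> connect (@adj G) r q'.
  by move=> rq qq'; apply: connect_trans rq (connect1 qq').
have rp2 := step _ _ rp1 e12; have rp3 := step _ _ rp2 e23.
have rp4 := step _ _ rp3 e34.
distinct U.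
have [e14 | ne14] := boolP (p1 -- p4).
  have closed x y :
      x \in [:: p1; p2; p3; p4] -> x -- y -> y \in [:: p1; p2; p3; p4].
    move=> xP xy; apply: contraT.
    rewrite !inE !negb_or => /and4P[y1 y2 y3 y4]; exfalso.
    move: xP xy; rewrite !inE => /or4P[] /eqP-> e;
      [ apply: (@no5r y p1 p2 p3 p4) | apply: (@no5r y p2 p3 p4 p1)
      | apply: (@no5r y p3 p4 p1 p2) | apply: (@no5r y p4 p1 p2 p3)];
      by [apply: step e | by_known].
  have opposite q1 q3 a b : ~~ (q1 -- q3) ->
      [:: q1; q3; a; b] =i [:: p1; p2; p3; p4] -> covers a b r.
    move=> ne13 eqset.
    apply: (@covers_closed (mem [:: p1; p2; p3; p4]) _ p1) => //=.
      by rewrite inE eqxx.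
    move=> x y xP xy; have yP := closed x y xP xy; split=> //.
    move: xP yP; rewrite -!eqset !(mem_cat _ [:: _; _] [:: _; _]).
    case/orP=> [xq|->//]; case/orP=> [yq|->]; rewrite ?orbT //.
    move: xq yq xy; rewrite !inE.
    by do 2!case/orP=> /eqP->;
      rewrite ?adj_irrefl ?(negPf ne13) 1?adjC ?(negPf ne13).
  have [e13 | ne13] := boolP (p1 -- p3); last first.
    exists p2, p4; apply: (opposite p1 p3 _ _ ne13) => x.
    by rewrite !inE; do 4!case: eqP.
  have [e24 | ne24] := boolP (p2 -- p4); last first.
    exists p1, p3; apply: (opposite p2 p4 _ _ ne24) => x.
    by rewrite !inE; do 4!case: eqP.
  by absurd_pattern K4 [:: p1; p2; p3; p4].
have end_P4 q1 q2 q3 q4 y : connect (@adj G) r q1 -> uniq [:: q1; q2; q3; q4] ->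
    q1 -- q2 -> q2 -- q3 -> q3 -- q4 -> ~~ (q1 -- q4) -> q1 -- y ->
    y \in [:: q2; q3].
  move=> rq1 Uq f12 f23 f34 nf14 f1y; apply: contraT; rewrite !inE !negb_or.
  case/andP=> y2 y3; distinct Uq; have y1 := neq_adj f1y.
  have y4 : y != q4 by apply: contraNneq nf14 => <-.
  by exfalso; apply: (@no5r y q1 q2 q3 q4); by [apply: step f1y | by_known].
exists p2, p3.
pose A x := [|| x \in [:: p1; p2; p3; p4], p2 -- x | p3 -- x].
apply: (@covers_closed A _ p1) => //; rewrite {}/A.
  by rewrite inE eqxx.
move=> x y Ax xy.
have [x23 | x23] := boolP (x \in [:: p2; p3]).
  by split=> //; move: x23 xy; rewrite !inE => /orP[] /eqP-> ->; rewrite !orbT.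
suff y23 : y \in [:: p2; p3].
  by rewrite y23; split=> //; move: y23; rewrite !inE => /orP[] ->; rewrite !orbT.
rewrite !inE negb_or in x23; case/andP: x23 => x2 x3.
have swap23 : (y \in [:: p2; p3]) = (y \in [:: p3; p2]) by rewrite !inE orbC.
have [x1 | x1] := eqVneq x p1; first by subst x; apply: (end_P4 p1 p2 p3 p4).
have [x4 | x4] := eqVneq x p4.
  by subst x; rewrite swap23; apply: (end_P4 p4 p3 p2 p1); by_known.
rewrite !inE (negPf x1) (negPf x2) (negPf x3) (negPf x4) /= in Ax.
(* If [x] is adjacent to both inner vertices, inserting it between them gives a
   P_5. *)
case/orP: Ax => e.
  apply: (end_P4 x p2 p3 p4); try by_known.
    exact: step e.
  by apply/negP => f; apply: (@no5r p1 p2 x p4 p3); by_known.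
rewrite swap23; apply: (end_P4 x p3 p2 p1); try by_known.
  exact: step e.
by apply/negP => f; apply: (@no5r p4 p3 x p1 p2); by_known.
Qed.

(** The component is a triangle or a star. *)
Lemma cover_P3 r :
  ~~ has_upath r 4 -> has_upath r 3 -> exists a b, covers a b r.
Proof.
move=> no4; case/existsP; case=> [[|p1 [|p2 [|p3 []]]]] //= _.
rewrite andbT => /and3P[rp1 /andP[e12 e23] U].
have no4r q1 q2 q3 q4 : connect (@adj G) r q1 ->
  q1 -- q2 -> q2 -- q3 -> q3 -- q4 -> uniq [:: q1; q2; q3; q4] -> False.
  move=> rq1 f12 f23 f34 Uq; case/negP: no4; apply/existsP.
  by exists [tuple q1; q2; q3; q4]; rewrite /= rq1 f12 f23 f34.
have step q q' : connect (@adj G) r q -> q -- q' -> connect (@adj G) r q'.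
  by move=> rq qq'; apply: connect_trans rq (connect1 qq').
have rp2 := step _ _ rp1 e12; have rp3 := step _ _ rp2 e23.
distinct U.
have end_P3 q1 q2 q3 y : connect (@adj G) r q1 -> uniq [:: q1; q2; q3] ->
    q1 -- q2 -> q2 -- q3 -> q1 -- y -> y \in [:: q2; q3].
  move=> rq1 Uq f12 f23 f1y; apply: contraT; rewrite !inE !negb_or.
  case/andP=> y2 y3; distinct Uq; have y1 := neq_adj f1y.
  by exfalso; apply: (@no4r y q1 q2 q3); by [apply: step f1y | by_known].
have [e13 | ne13] := boolP (p1 -- p3).
  exists p1, p2; apply: (@covers_closed (mem [:: p1; p2; p3]) _ p1) => //=.
    by rewrite inE eqxx.
  move=> x y; rewrite !inE => /or3P[] /eqP-> xy; rewrite ?eqxx ?orbT; split=> //.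
  - by have := @end_P3 p1 p2 p3 y; rewrite !inE => -> //; rewrite ?orbT.
  - have := @end_P3 p2 p1 p3 y; rewrite !inE orbCA => -> //;
      rewrite ?orbT //; by_known.
  - have := @end_P3 p3 p1 p2 y; rewrite !inE orbA => -> //;
      rewrite ?orbT //; by_known.
  have := @end_P3 p3 p1 p2 y; rewrite !inE => -> //; rewrite ?orbT //; by_known.
have end_P3' q1 q2 q3 y : connect (@adj G) r q1 -> uniq [:: q1; q2; q3] ->
    q1 -- q2 -> q2 -- q3 -> ~~ (q1 -- q3) -> q1 -- y -> y = q2.
  move=> rq1 Uq f12 f23 nf13 f1y; have := end_P3 q1 q2 q3 y rq1 Uq f12 f23 f1y.
  by rewrite !inE => /orP[/eqP// | /eqP y3]; rewrite -y3 f1y in nf13.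
exists p2, p2.
apply: (@covers_closed (fun x => (x == p2) || (p2 -- x)) _ p2) => //.
  by rewrite eqxx.
move=> x y Ax xy; have [x2 | x2] := eqVneq x p2.
  by subst x; split; rewrite ?xy ?inE ?eqxx ?orbT.
suff -> : y = p2 by split; rewrite ?inE eqxx ?orbT.
rewrite (negPf x2) /= in Ax.
have [x1 | x1] := eqVneq x p1; first by subst x; apply: (end_P3' p1 p2 p3).
have [x3 | x3] := eqVneq x p3.
  by subst x; apply: (end_P3' p3 p2 p1); by_known.
apply: (end_P3' x p2 p3); try by_known; first exact: step Ax.
by apply/negP => f; apply: (@no4r p1 p2 x p3); by_known.
Qed.

Lemma cover_P2 r : ~~ has_upath r 3 -> exists a b, covers a b r.
Proof.
move=> no3; exists r, r.
apply: (@covers_closed (fun x => (x == r) || (r -- x)) _ r) => //.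
  by rewrite eqxx.
move=> x y; rewrite !inE !orbb => /predU1P[-> -> | rx xy].
  by rewrite eqxx orbT.
suff /eqP-> : y == r by split; rewrite eqxx ?orbT.
apply: contraNT no3 => yr; apply/existsP; exists [tuple r; x; y] => /=.
rewrite connect0 rx xy !inE negb_or /= !andbT [r == y]eq_sym yr.
by rewrite ![_ == x]eq_sym !(neq_adj rx, neq_adj xy) eq_sym (neq_adj xy).
Qed.

Lemma component_cover r : exists a b, covers a b r.
Proof.
have [/cover_P5 // | no5] := boolP (has_upath r 5).
have [/(cover_P4 no5) // | no4] := boolP (has_upath r 4).
have [/(cover_P3 no4) // | no3] := boolP (has_upath r 3).
exact: cover_P2 no3.
Qed.

End PatternFree.

Lemma colorable3_free s (G : sgraph) :
  packing_sequence s -> s 0 = 1 -> 4 <= s 1 ->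
  packing_colorable s G 3 = ~~ has (contains G) patterns.
Proof.
move=> hs s0 s1; apply/idP/idP => [col3 | /hasPn free].
  apply: contraL col3 => /hasP[F patF GF].
  exact: uncolorable_contains hs s0 s1 (allP patterns_uncolorable F patF) GF.
have /fin_all_exists[W WP] (r : G) : exists W : seq G, size W <= 2 /\
    forall x y, connect (@adj G) r x -> adj x y -> (x \in W) || (y \in W).
  by have [a [b abP]] := component_cover free r; exists [:: a; b].
apply: (cover_colorable (W := W)) => // [r | x y xy]; first by have [] := WP r.
have [_ cov] := WP (root (@adj G) x); apply: cov xy.
by rewrite (sym_connect_sym (@adj_sym G)) connect_root.
Qed.

(** * Searching for placements *)

Definition extends (c : bool -> bool -> bool) (f g : rel nat) (q : seq nat) x :=
  (x \notin q)
  && all (fun i => c (f i (size q)) (g (nth 0 q i) x)) (iota 0 (size q)).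

(** Depth-first search for [m] further entries below [n].  The test [step] on
    each new entry only prunes the search: whatever is found satisfies [P]. *)
Fixpoint search (step : seq nat -> pred nat) (P : pred (seq nat)) n m q : bool :=
  if m is m'.+1 then
    has (fun x => step q x && search step P n m' (rcons q x)) (iota 0 n)
  else P q.

Lemma searchP step P n m q : search step P n m q -> exists q', P q'.
Proof.
by elim: m q => [|m IHm] q /=; [exists q | case/hasP=> x _ /andP[_ /IHm]].
Qed.

Definition placement n (q : seq nat) m :=
  [&& size q == m, uniq q & all (fun x => x < n) q].

Definition occurs (F : pattern) n (g : rel nat) : bool :=
  search (extends implb (edge F.2) g)
    (fun q => placement n q F.1
              && all (fun e => g (nth 0 q e.1) (nth 0 q e.2)) F.2)
    n F.1 [::].

Lemma patterns_bounded :
  all (fun F => (0 < F.1) && all (fun e => (e.1 < F.1) && (e.2 < F.1)) F.2)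
      patterns.
Proof. by []. Qed.

Lemma occurs_contains (G : sgraph) F n (g : rel nat) (phi : nat -> G) :
  F \in patterns ->
  (forall i j, i < n -> j < n -> phi i = phi j -> i = j) ->
  (forall i j, i < n -> j < n -> g i j -> adj (phi i) (phi j)) ->
  occurs F n g -> contains G F.
Proof.
move=> /(allP patterns_bounded)/andP[_ /allP bF] phi_inj phi_adj.
case/searchP=> q /andP[/and3P[/eqP sizeq Uq /allP ltq] /allP gF].
apply/containsP; exists (phi 0), (map phi q).
apply/and3P; split; first by rewrite size_map sizeq.
  by rewrite map_inj_in_uniq // => i j /ltq lti /ltq ltj; apply: phi_inj.
apply/allP => e Fe; have /andP[lt1 lt2] := bF e Fe.
rewrite !(nth_map 0) ?sizeq //.
by apply: phi_adj (gF e Fe); apply/ltq/mem_nth; rewrite sizeq.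
Qed.

(** A copy of a pattern that misses a vertex [u] survives in [del_vertex u], which
    is then not 3-colorable. *)
Lemma spanning s (G : sgraph) F :
  packing_sequence s -> s 0 = 1 -> 4 <= s 1 ->
  (forall u : G, packing_colorable s (del_vertex u) 3) ->
  F \in patterns -> contains G F -> F.1 = #|G|.
Proof.
move=> hs s0 s1 col patF /containsP[x0 [vs /and3P[/eqP sizevs Uvs /allP Fvs]]].
have /andP[F_gt0 /allP bF] := allP patterns_bounded F patF.
rewrite -sizevs -(card_uniqP Uvs); apply: eq_card => u.
apply: contraTT (col u) => vs'u.
have ne_u x : x \in vs -> x != u by apply: contraTneq => ->.
have y0u : nth x0 vs 0 != u by rewrite ne_u // mem_nth ?sizevs.
pose f := insubd (Sub (nth x0 vs 0) y0u : del_vertex u).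
have fK x : x \in vs -> val (f x) = x by move/ne_u => xu; rewrite val_insubd xu.
rewrite colorable3_free // negbK; apply/hasP; exists F => //.
apply/containsP; exists (f x0), (map f vs).
apply/and3P; split; first by rewrite size_map sizevs.
  by rewrite map_inj_in_uniq // => x y xvs yvs eqf; rewrite -(fK x) // eqf fK.
apply/allP => e Fe; have /andP[lt1 lt2] := bF e Fe.
rewrite !(nth_map x0) ?sizevs //= /del_adj !fK ?mem_nth ?sizevs //.
exact: Fvs.
Qed.

(** * The listed graphs *)

(** The pair [(n, r)] stands for a graph on ['I_n.+1], nonempty so that [inord]
    maps numbers back to vertices; its relation is on numbers, which lets closed
    instances be computed. *)
Definition code := (nat * rel nat)%type.
Definition decode (t : code) : sgraph :=
  graph_of_rel (fun i j : 'I_t.1.+1 => t.2 i j).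
Definition code_adj (t : code) : rel nat :=
  fun i j => (i != j) && (t.2 i j || t.2 j i).

Lemma decode_adj t (i j : decode t) : adj i j = code_adj t (val i) (val j).
Proof. by []. Qed.

Definition cycle_rel n : rel nat := fun i j => j == i.+1 %% n.
Definition chord_rel n (es : seq (nat * nat)) : rel nat := fun i j =>
  ((i != j) && (cycle_rel n i j || cycle_rel n j i)) || ((i.+1, j.+1) \in es).
Definition edges_rel (es : seq (nat * nat)) : rel nat := fun i j => (i, j) \in es.

Definition codes : seq code :=
  [:: (3, fun _ _ => true); (4, cycle_rel 5); (5, cycle_rel 6);
      (5, fun i j => j == i.+1)]
  ++ [seq (4, chord_rel 5 es) | es <-
       [:: [:: (1, 3)]; [:: (1, 3); (1, 4)]; [:: (1, 3); (2, 4)];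
           [:: (1, 4); (2, 5); (3, 5)]]]
  ++ [seq (5, chord_rel 6 es) | es <-
       [:: [:: (1, 4)]; [:: (1, 4); (2, 5)]; [:: (1, 4); (2, 5); (3, 6)]]]
  ++ [:: (4, edges_rel [:: (0, 1); (1, 2); (2, 3); (3, 0); (1, 3); (0, 4)]);
         (4, edges_rel [:: (0, 1); (1, 2); (2, 0); (2, 3); (3, 4); (4, 2)]);
         (5, edges_rel [:: (0, 1); (1, 2); (2, 0); (0, 3); (1, 4); (2, 5)]);
         (4, edges_rel [:: (0, 1); (1, 2); (2, 0); (1, 3); (3, 4)]);
         (5, edges_rel [:: (0, 1); (1, 2); (2, 3); (3, 0); (1, 5); (2, 4)]);
         (5, edges_rel [:: (0, 1); (1, 2); (2, 3); (3, 0); (2, 4); (4, 5)]);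
         (5, edges_rel [:: (0, 1); (1, 2); (2, 3); (3, 0); (2, 4); (1, 5); (3, 5)]);
         (5, edges_rel [:: (0, 1); (1, 2); (2, 3); (3, 4); (2, 5)])].

Lemma decode_codes :
  [:: complete_graph 4; cycle_graph 5; cycle_graph 6; path_graph 6]
    ++ family_C5 ++ family_C6 ++ [:: H1; H2; H3; H4; H5; H6; H7; H8]
  = map decode codes.
Proof. by []. Qed.

(** The pattern excludes 3-colorings.  The covers [u], [a], [b] yield both a
    4-coloring and, for every [u], a 3-coloring after the deletion of [u]. *)
Definition minimal_code (t : code) : bool :=
  let n := t.1.+1 in
  has (fun F => occurs F n (code_adj t)) patterns &&
  all (fun u => has (fun a => has (fun b =>
      all (fun i => all (fun j =>
          code_adj t i j ==> has (fun z => (z == i) || (z == j)) [:: u; a; b])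
        (iota 0 n)) (iota 0 n)) (iota 0 n)) (iota 0 n)) (iota 0 n).

Lemma codes_minimal : all minimal_code codes.
Proof. by lazy. Qed.

(** [matches n es t] searches for an isomorphism from the graph on 0, ..., n - 1
    with edges [es] to the graph coded by [t]. *)
Definition matches n es (t : code) : bool :=
  (n == t.1.+1) &&
  search (extends eqb (edge es) (code_adj t))
    (fun q => placement n q n &&
      all (fun p => edge es p.1 p.2
                    == code_adj t (nth 0 q p.1) (nth 0 q p.2)) (pairs n))
    n n [::].

Definition has_smaller n es : bool :=
  has (fun F => (F.1 < n) && occurs F n (edge es)) patterns.

(** A binary search tree over the graphs whose edges are [es] and some of the
    pairs in [undecided]; a branch is cut once it contains a pattern on fewer
    than [n] vertices. *)
Fixpoint classify (ts : seq code) n es (undecided : seq (nat * nat)) : bool :=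
  if undecided is p :: ps then
    classify ts n es ps && (has_smaller n (p :: es) || classify ts n (p :: es) ps)
  else has_smaller n es || has (matches n es) ts.

Definition classified (F : pattern) : bool :=
  classify codes F.1 F.2 [seq p <- pairs F.1 | ~~ edge F.2 p.1 p.2].

(** Most chords are cut at once: in P_6, for instance, a chord between vertices
    of the same parity gives a flag or a C_5, which leaves only the bipartite
    graphs on the two parity classes. *)
Lemma patterns_classified : all classified patterns.
Proof. by lazy. Qed.

(** * From the finite check to graphs *)

(** Codes contain functions, hence have no decidable equality: their membership
    is [List.In]. *)
Lemma has_In T (a : pred T) l : has a l -> exists2 x, List.In x l & a x.
Proof.
elim: l => //= y l IHl /orP[ay | /IHl[x lx ax]]; first by exists y; [left |].
by exists x; [right |].
Qed.

Lemma all_In T (a : pred T) l x : all a l -> List.In x l -> a x.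
Proof. by elim: l => //= y l IHl /andP[ay al] [<- // | /(IHl al)]. Qed.

Lemma In_map (T U : Type) (f : T -> U) l y :
  List.In y (map f l) -> exists2 x, List.In x l & y = f x.
Proof.
elim: l => //= x l IHl [<- | /IHl[x' lx' ->]]; first by exists x; [left |].
by exists x'; [right |].
Qed.

Lemma matches_isomorphic (G : sgraph) n es (x0 : G) vs t :
  size vs = n -> uniq vs -> (forall x, x \in vs) ->
  (forall p, p \in pairs n ->
     adj (nth x0 vs p.1) (nth x0 vs p.2) = edge es p.1 p.2) ->
  matches n es t -> isomorphic G (decode t).
Proof.
move=> sizevs Uvs vsP esP /andP[/eqP def_n /searchP[q /andP[]]].
case/and3P=> /eqP sizeq Uq /allP ltq /allP mq.
have lt_idx x : index x vs < n by rewrite -sizevs index_mem.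
have lt_q i : i < n -> nth 0 q i < t.1.+1.
  by rewrite -sizeq -def_n => /(mem_nth 0)/ltq.
pose f (x : G) : decode t := Ordinal (lt_q _ (lt_idx x)).
have f_inj : injective f.
  move=> x y /(congr1 val) /= /eqP; rewrite nth_uniq ?sizeq // => /eqP eq_idx.
  by rewrite -(nth_index x0 (vsP x)) eq_idx nth_index.
exists f.
  apply: inj_card_bij f_inj _; rewrite card_ord -def_n -sizevs -(card_uniqP Uvs).
  exact: max_card.
have main x y : index y vs < index x vs -> adj (f x) (f y) = adj x y.
  move=> lt_yx; have p_n : (index x vs, index y vs) \in pairs n.
    apply/allpairsPdep; exists (index x vs), (index y vs).
    by rewrite !mem_iota lt_idx.
  by rewrite decode_adj /= -(eqP (mq _ p_n)) -(esP _ p_n) !nth_index.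
move=> x y; case: (ltngtP (index y vs) (index x vs)) => [|lt_xy|eq_idx].
- exact: main.
- by rewrite adj_sym main // adj_sym.
by rewrite -(nth_index x0 (vsP x)) -eq_idx nth_index // !adj_irrefl.
Qed.

(** Follow the branch of [classify] that decides each pair as [G] does, [vs]
    being a numbering of the vertices of [G]. *)
Lemma classifyP (G : sgraph) ts n es undecided (x0 : G) vs :
  size vs = n -> uniq vs -> (forall x, x \in vs) ->
  (forall F, F \in patterns -> F.1 < n -> ~~ contains G F) ->
  (forall i j, edge es i j -> adj (nth x0 vs i) (nth x0 vs j)) ->
  (forall p, p \in pairs n -> adj (nth x0 vs p.1) (nth x0 vs p.2) ->
     edge es p.1 p.2 || (p \in undecided)) ->
  classify ts n es undecided -> mem_up_to_iso G (map decode ts).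
Proof.
move=> sizevs Uvs vsP no_small.
have not_small es' :
    (forall i j, edge es' i j -> adj (nth x0 vs i) (nth x0 vs j)) ->
    has_smaller n es' = false.
  move=> es'P; apply/hasPn => F patF; apply/negP => /andP[ltFn].
  apply/negP; apply: contra (no_small F patF ltFn).
  apply: (@occurs_contains G F n _ (nth x0 vs)) => // [i j lti ltj /eqP | i j _ _];
    last exact: es'P.
  by rewrite nth_uniq ?sizevs // => /eqP.
elim: undecided es => [|p ps IHps] es esP sub /=.
  rewrite (not_small es esP) orFb => /has_In[t codes_t match_t].
  exists (decode t); first exact: List.in_map.
  apply: (matches_isomorphic (x0 := x0) sizevs Uvs vsP _ match_t) => p p_n.
  apply/idP/idP => [/(sub p p_n) | /esP //]; by rewrite orbF.
case/andP=> cl0 cl1.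
have [adj_p | adj_p] := boolP (adj (nth x0 vs p.1) (nth x0 vs p.2)).
  have pesP i j : edge (p :: es) i j -> adj (nth x0 vs i) (nth x0 vs j).
    rewrite /edge !inE; case/orP=> /predU1P[eq_p | ij].
    - by rewrite -eq_p in adj_p.
    - by apply: esP; rewrite /edge ij.
    - by rewrite adj_sym; rewrite -eq_p in adj_p.
    by apply: esP; rewrite /edge ij orbT.
  apply: (IHps (p :: es)) => // [p' p'_n adj_p' |]; last first.
    by rewrite not_small in cl1.
  have := sub p' p'_n adj_p'; rewrite /edge !inE -!surjective_pairing.
  by case: (p' == p); case: (p' \in es); case: (p' \in ps) => //=;
    rewrite ?orbT ?orbF // => ->; rewrite ?orbT.
apply: IHps cl0 => // p' p'_n adj_p'.
have := sub p' p'_n adj_p'; rewrite inE.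
by have [eq_p | //] := eqVneq p' p; rewrite -eq_p adj_p' in adj_p.
Qed.

Lemma critical_is_listed s (G : sgraph) :
  packing_sequence s -> s 0 = 1 -> 4 <= s 1 ->
  k_chi_vertex_critical s 4 G -> mem_up_to_iso G (map decode codes).
Proof.
move=> hs s0 s1 [crit chi4].
have col (u : G) : packing_colorable s (del_vertex u) 3.
  by rewrite -packing_chi_le; have := crit u; rewrite chi4.
have : has (contains G) patterns.
  by rewrite -[has _ _]negbK -(colorable3_free G hs s0 s1) -packing_chi_le chi4.
case/hasP=> F patF GF.
have sizeF := spanning hs s0 s1 col patF GF.
have [x0 [vs Fvs]] := containsP _ _ GF; have /and3P[/eqP sizevs Uvs _] := Fvs.
have vsP x : x \in vs.
  have card_vs : #|vs| = #|G| by rewrite (card_uniqP Uvs) sizevs.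
  by rewrite (subset_cardP card_vs (subset_predT _) x).
apply: (classifyP sizevs Uvs vsP _ _ _ (allP patterns_classified F patF)).
- move=> F' patF' ltF'; apply: contraL ltF' => GF'.
  by rewrite sizeF -(spanning hs s0 s1 col patF' GF') ltnn.
- by move=> i j; apply: (realizes_adj Fvs).
by move=> p p_n _; rewrite mem_filter p_n andbT orbN.
Qed.

Lemma listed_is_critical s (G : sgraph) :
  packing_sequence s -> s 0 = 1 -> 4 <= s 1 ->
  mem_up_to_iso G (map decode codes) -> k_chi_vertex_critical s 4 G.
Proof.
move=> hs s0 s1 [H H_in].
have [t codes_t ->{H H_in}] := In_map H_in.
move=> [f [g fK gK] f_adj].
have /andP[/hasP[F patF occF] /allP cov] := all_In codes_minimal codes_t.
pose phi i := g (inord i).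
pose idx (x : G) : nat := nat_of_ord (f x).
have idx_iota x : idx x \in iota 0 t.1.+1 by rewrite mem_iota ltn_ord.
have phiK x : phi (idx x) = x by rewrite /phi inord_val fK.
have phi_adj i j : i < t.1.+1 -> j < t.1.+1 ->
    adj (phi i) (phi j) = code_adj t i j.
  by move=> lti ltj; rewrite -f_adj !gK decode_adj /= !inordK.
have GF : contains G F.
  apply: (occurs_contains (phi := phi) patF _ _ occF) => i j lti ltj.
    move/(congr1 f).
    by rewrite /phi !gK => /(congr1 val); rewrite /= !inordK.
  by rewrite phi_adj.
have cover u : exists a b, forall x y : G, adj x y ->
    has (fun z => (z == x) || (z == y)) [:: u; a; b].
  have /cov/hasP[a _ /hasP[b _ /allP covu]] : idx u \in iota 0 t.1.+1 by [].
  exists (phi a), (phi b) => x y xy.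
  have /implyP := allP (covu _ (idx_iota x)) _ (idx_iota y).
  rewrite -phi_adj ?ltn_ord // !phiK => /(_ xy) h; have [z] := hasP h.
  rewrite !inE => z_uab z_xy; apply/hasP; exists (phi z).
    by case/or3P: z_uab => /eqP->; rewrite ?phiK !inE eqxx ?orbT.
  by case/orP: z_xy => /eqP->; rewrite phiK eqxx ?orbT.
have chi_gt3 : 3 < packing_chi s G.
  rewrite ltnNge packing_chi_le colorable3_free // negbK.
  by apply/hasP; exists F.
split=> [u |].
  apply: leq_trans chi_gt3; rewrite ltnS packing_chi_le.
  have [a [b ab_cov]] := cover u.
  (* [a] or [b] may be [u] itself, which [insub] drops. *)
  pose W : seq (del_vertex u) := pmap insub [:: a; b].
  apply: (cover_colorable (W := fun=> W)) => // [_ | x y xy /=].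
    by rewrite size_pmap (leq_trans (count_size _ _)).
  rewrite !mem_pmap_sub; have /= := ab_cov _ _ xy.
  rewrite !inE !(eq_sym u) (negPf (valP x)) (negPf (valP y)) /=.
  by rewrite !(eq_sym a) !(eq_sym b); do 4!case: eqP.
apply/eqP; rewrite eqn_leq chi_gt3 andbT packing_chi_le.
have [a [b ab_cov]] := cover (phi 0).
apply: (cover_colorable (W := fun=> [:: phi 0; a; b])) => // x y xy.
by case/hasP: (ab_cov _ _ xy) => z z_uab /orP[] /eqP <-; rewrite z_uab ?orbT.
Qed.

Theorem theorem3p5 (s : nat -> nat) (hs : packing_sequence s)
    (hs1 : s 0 = 1) (hs2 : 4 <= s 1) (G : sgraph) :
  k_chi_vertex_critical s 4 G <->
  mem_up_to_iso G
    ([:: complete_graph 4; cycle_graph 5; cycle_graph 6; path_graph 6]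
     ++ family_C5 ++ family_C6 ++ [:: H1; H2; H3; H4; H5; H6; H7; H8]).
Proof.
rewrite decode_codes; split; first exact: critical_is_listed.
exact: listed_is_critical.
Qed.
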